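(* Let $(X,\mathcal{X})$ be a measurable space, $\Theta$ be a nonempty open interval of $\mathbb{R}$, $f:\Theta\to\mathbb{R}$ be a strictly increasing function, and $p:X\to(0,\infty)$ and $\varphi:X\to\operatorname{conv}(f(\Theta))$ be measurable functions. Define $\psi:X\times\Theta\to\mathbb{R}$ by $$\psi(x,t):=p(x)(\varphi(x)-f(t)),\qquad x\in X,\ t\in\Theta.$$ Further, let $(\Omega,\mathcal{A},\mathbb{P})$ be a probability space and $\xi:\Omega\to X$ be a random variable such that $\mathbb{E}(p(\xi)|\varphi(\xi)|)<\infty$ and $\mathbb{E}(p(\xi))<\infty$. Then the function $\Theta\ni t\mapsto\mathbb{E}(\psi(\xi,t))$ admits a unique point of sign change in $\Theta$, which is given by $$f^{(-1)}\bigg(\frac{\mathbb{E}(p(\xi)\varphi(\xi))}{\mathbb{E}(p(\xi))}\bigg).$$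
   Context: $\operatorname{conv}(S)$ denotes the convex hull of $S\subseteq\mathbb{R}$ (the smallest interval containing $S$). Generalized left inverse: for a strictly increasing (not necessarily continuous) $f:\Theta\to\mathbb{R}$ on a nonempty open interval $\Theta$, $f^{(-1)}:\operatorname{conv}(f(\Theta))\to\Theta$ denotes the uniquely determined monotone function with $f^{(-1)}(f(u))=u$ for all $u\in\Theta$; it is increasing and continuous, and $f^{(-1)}(y)=\sup\{u\in\Theta:f(u)\leq y\}=\inf\{u\in\Theta:f(u)\geq y\}$ for $y\in\operatorname{conv}(f(\Theta))$. Point of sign change: for $g:\Theta\to\mathbb{R}$, an element $\vartheta\in\Theta$ is a point of sign change (of decreasing type) for $g$ if $g(t)>0$ for all $t\in\Theta$ with $t<\vartheta$ and $g(t)<0$ for all $t\in\Theta$ with $t>\vartheta$. *)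

(* Defs.v *)
From mathcomp Require Import all_boot all_order all_algebra.
From mathcomp Require Import all_classical all_reals all_analysis.
Import Order.TTheory GRing.Theory Num.Theory.
Import numFieldNormedType.Exports.

Set Implicit Arguments.
Unset Strict Implicit.
Unset Printing Implicit Defensive.

Local Open Scope classical_set_scope.
Local Open Scope ring_scope.

(* Functions on an interval [Theta] are total functions on [R]; only their
   values on [Theta] matter in the definitions below. *)

Section Definitions.
Context {R : realType}.
Implicit Types (S Theta : set R) (f g : R -> R) (y th : R).

Definition conv_hull S : set R := smallest (@is_interval R) S.

(* [g], restricted to [conv_hull (f @` Theta)], is a monotone (in either
   direction) [Theta]-valued left inverse of [f]. *)
Definition is_gen_left_inverse Theta f g :=
  [/\ forall y, conv_hull (f @` Theta) y -> Theta (g y),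
      {in conv_hull (f @` Theta) &, {homo g : x y / x <= y}} \/
      {in conv_hull (f @` Theta) &, {homo g : x y /~ x <= y}} &
      {in Theta, cancel f g}].

(* The function f^(-1). By [gen_left_inverseP] and [is_gen_left_inverse_uniq]
   this choice exists and is determined on [conv_hull (f @` Theta)]; its values
   elsewhere are arbitrary. *)
Definition gen_left_inverse Theta f : R -> R :=
  get (is_gen_left_inverse Theta f).

Definition sign_change_point Theta g th :=
  [/\ Theta th, forall t, Theta t -> t < th -> 0 < g t
    & forall t, Theta t -> th < t -> g t < 0].

Definition psi (X : Type) (p phi : X -> R) f (x : X) (t : R) : R :=
  p x * (phi x - f t).

Lemma conv_hullP S y : conv_hull S y ->
  exists a b, [/\ S a, S b & a <= y <= b].
Proof.
move=> /(_ [set y | exists a b, [/\ S a, S b & a <= y <= b]]); apply; split.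
- move=> u v [a [_ [Sa _ /andP[au _]]]] [_ [b [_ Sb /andP[_ vb]]]] z.
  move=> /andP[uz zv]; exists a, b; split => //.
  by rewrite (le_trans au uz) (le_trans zv vb).
- by move=> a Sa; exists a, a; rewrite lexx.
Qed.

Section GenLeftInverse.
Variables (Theta : set R) (f : R -> R).
Hypotheses (iTheta : is_interval Theta).
Hypothesis fincr : {in Theta &, {homo f : s t / s < t}}.

Let S y := [set u | Theta u /\ f u <= y].
Let hull := conv_hull (f @` Theta).

Let hull_f u : Theta u -> hull (f u).
Proof. by move=> Tu; apply: sub_gen_smallest; exists u. Qed.

Let f_le u v : Theta u -> Theta v -> f u <= f v -> u <= v.
Proof.
move=> Tu Tv; rewrite !leNgt; apply: contra => vu.
by apply: fincr => //; rewrite inE.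
Qed.

Let hull_bounds y : hull y ->
  exists a b, [/\ S y a, Theta b & ubound (S y) b].
Proof.
move=> /conv_hullP [_ [_ [[a Ta <-] [b Tb <-] /andP[ay yb]]]].
exists a, b; split => // u [Tu uy].
by apply: f_le => //; apply: le_trans yb.
Qed.

Let has_supS y : hull y -> has_sup (S y).
Proof. by move=> /hull_bounds [a [b [Sa _ ub]]]; split; [exists a|exists b]. Qed.

Lemma is_gen_left_inverse_sup :
  is_gen_left_inverse Theta f (fun y => sup [set u | Theta u /\ f u <= y]).
Proof.
split.
- move=> y hy; have [a [b [Sa Tb ub]]] := hull_bounds hy.
  apply: (iTheta (proj1 Sa) Tb); apply/andP; split.
    exact: sup_upper_bound (has_supS hy) _ Sa.
  by apply: ge_sup => //; exists a.
- left => x y; rewrite !inE => hx hy xy; apply: ge_sup.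
    by have [] := has_supS hx.
  move=> u [Tu ux]; apply: (sup_upper_bound (has_supS hy)).
  by split => //; apply: le_trans xy.
- move=> u; rewrite inE => Tu; apply/eqP; rewrite eq_le; apply/andP; split.
    apply: ge_sup; first by exists u; split.
    by move=> v [Tv]; apply: f_le.
  by apply: (sup_upper_bound (has_supS (hull_f Tu))); split.
Qed.

Lemma gen_left_inverseP :
  is_gen_left_inverse Theta f (gen_left_inverse Theta f).
Proof. exact: (getI is_gen_left_inverse_sup). Qed.

Hypotheses (oTheta : open Theta) (Theta0 : Theta !=set0).

Lemma is_gen_left_inverse_supE g y : is_gen_left_inverse Theta f g ->
  conv_hull (f @` Theta) y -> g y = sup [set u | Theta u /\ f u <= y].
Proof.
move=> [gT gmon gK] hy.
have {}gmon : {in hull &, {homo g : x y / x <= y}}.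
  case: gmon => // gdec; exfalso.
  have [a Ta] := Theta0.
  have /nbhs_ballP[e /= e0 aeT] := open_nbhs_nbhs (conj oTheta Ta).
  have Tb : Theta (a + e / 2).
    apply: aeT; rewrite /ball /= opprD addNKr normrN gtr0_norm ?divr_gt0//.
    by rewrite ltr_pdivrMr// mulr_natr mulr2n ltrDl.
  have ab : a < a + e / 2 by rewrite ltrDl divr_gt0.
  have fab : f a < f (a + e / 2) by apply: fincr; rewrite ?inE.
  have := gdec (f (a + e / 2)) (f a).
  rewrite !inE => /(_ (hull_f Tb) (hull_f Ta) (ltW fab)).
  by rewrite !gK ?inE// leNgt ab.
have [sT _ _] := is_gen_left_inverse_sup.
apply/eqP; rewrite eq_le; apply/andP; split; last first.
  apply: ge_sup; first by have [] := has_supS hy.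
  move=> u [Tu uy]; rewrite -[u]gK ?inE//.
  by apply: gmon => //; rewrite inE//; exact: hull_f.
rewrite leNgt; apply/negP => lt_s.
have [w1 w2] := midf_lt lt_s.
set w := _ / 2 in w1 w2.
have Tw : Theta w.
  by apply: (iTheta (sT _ hy) (gT _ hy)); rewrite !ltW.
have yfw : y <= f w.
  rewrite leNgt; apply/negP => fwy; move: w1; rewrite ltNge => /negP; apply.
  by apply: (sup_upper_bound (has_supS hy)); split => //; exact: ltW.
have : g y <= g (f w) by apply: gmon; rewrite ?inE//; exact: hull_f.
by rewrite gK ?inE// leNgt w2.
Qed.

Lemma is_gen_left_inverse_uniq g1 g2 :
  is_gen_left_inverse Theta f g1 -> is_gen_left_inverse Theta f g2 ->
  {in conv_hull (f @` Theta), g1 =1 g2}.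
Proof.
move=> g1P g2P y; rewrite inE => hy.
by rewrite (is_gen_left_inverse_supE g1P hy) (is_gen_left_inverse_supE g2P hy).
Qed.

End GenLeftInverse.
End Definitions.

(* Main.v *)
Require Import Defs.
From mathcomp Require Import all_boot all_order all_algebra.
From mathcomp Require Import all_classical all_reals all_analysis.
From mathcomp Require Import measurable_realfun.
Import Order.TTheory GRing.Theory Num.Theory.
Import numFieldNormedType.Exports.

Set Implicit Arguments.
Unset Strict Implicit.
Unset Printing Implicit Defensive.

Local Open Scope classical_set_scope.
Local Open Scope ring_scope.

(** Since [f t] is a constant as far as [xi] is concerned, linearity gives
    E (psi (xi, t)) = E p * (m - f t) with m = E (p phi) / E p, the mean of
    [phi (xi)] with weight [p (xi)] ([weighted_mean_sub]).  As E p > 0, the sign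
    of the expectation at [t] is the sign of m - f t, and the claim becomes a
    statement about [f] alone.

    Two facts are needed.  A mean with positive weights of values in an interval
    stays in that interval, so [m] belongs to the convex hull of [f @` Theta],
    the domain on which [f^(-1)] is meaningful ([weighted_mean_interval]).  And
    for [y] in that hull, f^(-1)(y) is where [f] passes the level [y], strictly
    on both sides even if [f] jumps over [y] ([lt_gen_left_inverse] and
    [gen_left_inverse_lt]).

    Uniqueness holds for every function on an interval: at the midpoint of two
    distinct points of sign change it would be both negative and positive
    ([sign_change_point_uniq]). *)

Lemma sign_change_point_uniq (R : realType) (Theta : set R) (g : R -> R) :
  is_interval Theta -> forall th1 th2,
  sign_change_point Theta g th1 -> sign_change_point Theta g th2 -> th1 = th2.
Proof.
move=> iTheta; suff le th1 th2 : sign_change_point Theta g th1 ->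
    sign_change_point Theta g th2 -> th2 <= th1.
  by move=> th1 th2 h1 h2; apply/eqP; rewrite eq_le !le.
move=> [T1 _ neg1] [T2 pos2 _]; rewrite leNgt; apply/negP => th12.
have [m1 m2] := midf_lt th12.
have Tm : Theta ((th1 + th2) / 2) by apply: (iTheta _ _ T1 T2); rewrite !ltW.
by have := lt_trans (neg1 _ Tm m1) (pos2 _ Tm m2); rewrite ltxx.
Qed.

Section GenLeftInverseLevel.
Context {R : realType} (Theta : set R) (f : R -> R).
Hypotheses (iTheta : is_interval Theta) (oTheta : open Theta).
Hypotheses (Theta0 : Theta !=set0).
Hypothesis fincr : {in Theta &, {homo f : s t / s < t}}.
Variable y : R.
Hypothesis hully : conv_hull (f @` Theta) y.

Let supE : gen_left_inverse Theta f y = sup [set u | Theta u /\ f u <= y].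
Proof. by apply: is_gen_left_inverse_supE => //; exact: gen_left_inverseP. Qed.

Let has_sup_sublevel : has_sup [set u | Theta u /\ f u <= y].
Proof.
have [_ [_ [[a Ta <-] [b Tb <-] /andP[ay yb]]]] := conv_hullP hully.
split; first by exists a.
exists b => u [Tu uy]; rewrite leNgt; apply/negP => bu.
have := fincr (mem_set Tb) (mem_set Tu) bu.
by rewrite ltNge (le_trans uy yb).
Qed.

Lemma gen_left_inverse_in : Theta (gen_left_inverse Theta f y).
Proof. by have [+ _ _] := gen_left_inverseP iTheta fincr; exact. Qed.

(** A point below the supremum is exceeded by some point of the sublevel set, so
    strict monotonicity makes the inequality strict. *)
Lemma lt_gen_left_inverse t :
  Theta t -> t < gen_left_inverse Theta f y -> f t < y.
Proof.
move=> Tt; rewrite supE => /(sup_gt has_sup_sublevel.1)[u [Tu uy] tu].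
by apply: lt_le_trans uy; apply: fincr; rewrite ?inE.
Qed.

Lemma gen_left_inverse_lt t :
  Theta t -> gen_left_inverse Theta f y < t -> y < f t.
Proof.
rewrite supE => Tt supt; rewrite ltNge; apply/negP => fty.
by move: supt; rewrite ltNge (sup_upper_bound has_sup_sublevel).
Qed.

End GenLeftInverseLevel.

(** Positivity at every point forces the positivity of the integral because the
    whole space is not a null set. *)
Lemma expectation_gt0 (R : realType) (d : measure_display)
  (Omega : measurableType d) (P : probability Omega R) (Y : Omega -> R) :
  measurable_fun setT Y -> (forall w, 0 < Y w) -> (0 < 'E_P[Y])%E.
Proof.
move=> mY Y0; have EY_ge0 : (0 <= 'E_P[Y])%E.
  by rewrite unlock; apply: integral_ge0 => w _; rewrite lee_fin ltW.
rewrite lt_neqAle EY_ge0 andbT eq_sym; apply/eqP; rewrite unlock => EY0.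
have : ae_eq P setT (EFin \o Y) (cst 0%E).
  apply/ae_eq_integral_abs => //; first exact/measurable_EFinP.
  by rewrite -[RHS]EY0; apply: eq_integral => w _ /=; rewrite gtr0_norm.
move=> [N [mN PN0 subN]]; have : (P setT <= P N)%E.
  apply: le_measure; rewrite ?inE// => w _; apply: subN => /= /(_ I) [Yw0].
  by have := Y0 w; rewrite Yw0 ltxx.
by rewrite PN0 probability_setT lee_fin ler10.
Qed.

Section WeightedMean.
Context {R : realType} {d : measure_display} {Omega : measurableType d}.
Variables (P : probability Omega R) (q Y : Omega -> R).
Hypotheses (mq : measurable_fun setT q) (q0 : forall w, 0 < q w).
Hypothesis mY : measurable_fun setT Y.
Hypothesis iq : ('E_P[q] < +oo)%E.
Hypothesis iqY : ('E_P[fun w => (q w * `|Y w|)%R] < +oo)%E.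

Let mean := fine ('E_P[fun w => (q w * Y w)%R])%E / fine ('E_P[q])%E.

Let q_integrable : P.-integrable setT (EFin \o q).
Proof.
apply/integrableP; split; first exact/measurable_EFinP.
move: iq; rewrite unlock; congr (_ < _)%E; apply: eq_integral => w _ /=.
by rewrite gtr0_norm.
Qed.

Let qY_integrable : P.-integrable setT (EFin \o (fun w => q w * Y w)).
Proof.
apply/integrableP; split.
  by apply/measurable_EFinP; exact: measurable_funM.
move: iqY; rewrite unlock; congr (_ < _)%E; apply: eq_integral => w _ /=.
by rewrite normrM (gtr0_norm (q0 w)).
Qed.

Lemma fine_expectation_weight_gt0 : 0 < fine ('E_P[q])%E.
Proof. by rewrite fine_gt0// expectation_gt0. Qed.

Lemma weighted_mean_sub c :
  ('E_P[fun w => (q w * (Y w - c))%R] = (fine 'E_P[q] * (mean - c))%:E)%E.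
Proof.
have Eq_neq0 := lt0r_neq0 fine_expectation_weight_gt0.
rewrite /mean mulrBr mulrCA divff// mulr1 EFinB EFinM muleC.
rewrite unlock !fineK ?integrable_fin_num//.
rewrite -integralZl// -integralB//; last exact: integrableZl.
by apply: eq_integral => w _; rewrite /= mulrBr EFinB (mulrC _ c).
Qed.

(** If the mean [m] lay outside [J], all values of [Y] would be on one side of
    [m], so [q * (Y - m)] would have a strict sign everywhere, while its
    expectation is zero. *)
Lemma weighted_mean_interval (J : set R) :
  is_interval J -> (forall w, J (Y w)) -> J mean.
Proof.
move=> iJ JY.
have E0 : 'E_P[fun w => (q w * (Y w - mean))%R]%E = 0%E.
  by rewrite weighted_mean_sub subrr mulr0.
have [w1 w1m] : exists w, Y w <= mean.
  apply: contrapT => /forallNP above.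
  suff : (0 < 'E_P[fun w => (q w * (Y w - mean))%R])%E by rewrite E0 ltxx.
  apply: expectation_gt0.
    by apply: measurable_funM => //; exact: measurable_funB.
  by move=> w; rewrite mulr_gt0// subr_gt0 ltNge; apply/negP.
have [w2 w2m] : exists w, mean <= Y w.
  apply: contrapT => /forallNP below.
  have pos w : 0 < q w * (mean - Y w).
    by rewrite mulr_gt0// subr_gt0 ltNge; apply/negP.
  suff : (0 < - 'E_P[fun w => (q w * (Y w - mean))%R])%E.
    by rewrite E0 oppe0 ltxx.
  suff -> : (- 'E_P[fun w => (q w * (Y w - mean))%R] =
      'E_P[fun w => (q w * (mean - Y w))%R])%E.
    apply: expectation_gt0 => //.
    by apply: measurable_funM => //; exact: measurable_funB.
  rewrite unlock -[RHS]oppeK -[X in _ = (- X)%E]integral_ge0N.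
    congr (- _)%E; apply: eq_integral => w _.
    by rewrite -(opprB (Y w)) mulrN EFinN oppeK.
  by move=> w _; rewrite lee_fin ltW.
by apply: (iJ _ _ (JY w1) (JY w2)); rewrite w1m w2m.
Qed.

End WeightedMean.

Theorem proposition3p4 (R : realType)
  (dX : measure_display) (X : measurableType dX)
  (Theta : set R) (Theta0 : Theta !=set0) (oTheta : open Theta)
  (iTheta : is_interval Theta)
  (f : R -> R) (fincr : {in Theta &, {homo f : s t / s < t}})
  (p phi : X -> R)
  (mp : measurable_fun [set: X] p) (p_gt0 : forall x, 0 < p x)
  (mphi : measurable_fun [set: X] phi)
  (phi_hull : forall x, conv_hull (f @` Theta) (phi x))
  (dO : measure_display) (Omega : measurableType dO) (P : probability Omega R)
  (xi : {RV P >-> X})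
  (int_pphi : ('E_P[fun w => (p (xi w) * `|phi (xi w)|)%R] < +oo)%E)
  (int_p : ('E_P[fun w => p (xi w)] < +oo)%E) :
  let Epsi := fun t => fine ('E_P[fun w => psi p phi f (xi w) t])%E in
  let th := gen_left_inverse Theta f
              (fine ('E_P[fun w => (p (xi w) * phi (xi w))%R])%E
               / fine ('E_P[fun w => p (xi w)])%E) in
  sign_change_point Theta Epsi th /\
  (forall th', sign_change_point Theta Epsi th' -> th' = th).
Proof.
move=> Epsi; set m := (X in gen_left_inverse _ _ X) => th.
have mpxi : measurable_fun setT (p \o xi) by exact: measurableT_comp.
have mphixi : measurable_fun setT (phi \o xi) by exact: measurableT_comp.
have pxi_gt0 w : 0 < (p \o xi) w by exact: p_gt0.
have hullm : conv_hull (f @` Theta) m.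
  apply: (weighted_mean_interval mpxi pxi_gt0 mphixi int_p int_pphi).
    by rewrite /conv_hull -Rhull_smallest; exact: interval_is_interval.
  by move=> w; exact: phi_hull.
have EpsiE t : Epsi t = fine ('E_P[p \o xi])%E * (m - f t).
  by rewrite /Epsi (weighted_mean_sub mpxi pxi_gt0 mphixi int_p int_pphi).
have Ep_gt0 := fine_expectation_weight_gt0 mpxi pxi_gt0 int_p.
have th_change : sign_change_point Theta Epsi th.
  split; first exact: gen_left_inverse_in.
  - move=> t Tt tth; rewrite EpsiE pmulr_rgt0// subr_gt0.
    exact: lt_gen_left_inverse tth.
  - move=> t Tt tth; rewrite EpsiE pmulr_rlt0// subr_lt0.
    exact: gen_left_inverse_lt tth.
by split => // th' h; exact: sign_change_point_uniq h th_change.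
Qed.
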